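(* Using one priority queue per $y$-grade (the column-queue variants described in the context), the algorithms Min_gens and Ker_basis produce the same output as in the Lesnick–Wright (LW) algorithm (the LW variants described in the context).
   Context: **Setting.** A graded matrix is a matrix over $\mathbb{Z}_2$ whose rows and columns are annotated with grades in $\mathbb{Z}^2$. A short chain complex $F^2\xrightarrow{\partial^2}F^1\xrightarrow{\partial^1}F^0$ of finitely generated free $2$-parameter persistence modules (functors $\mathbb{Z}^2\to\mathrm{Vec}_{\mathbb{Z}_2}$, for the product order on $\mathbb{Z}^2$, that are direct sums of modules $E^{\mathbf u}$ with $E^{\mathbf u}_{\mathbf z}=\mathbb{Z}_2$ for $\mathbf u\le\mathbf z$, $0$ otherwise, and identity maps between nonzero spaces) with $\partial^1\partial^2=0$ is given by graded matrices $A$ (for $\partial^2$) and $B$ (for $\partial^1$) with respect to ordered homogeneous bases; rows and columns carry the grades of the corresponding basis elements, so the grade of any row with a nonzero entry in a column is $\le$ the grade of the column. Rows and columns of the matrices are in co-lexicographic order of grades (compare $y$-coordinates first, then $x$-coordinates; equal grades ordered arbitrarily). All column grades lie in $\{1,\dots,X\}\times\{1,\dots,Y\}$. The pivot of a nonzero column is the largest row index with nonzero entry. Min_gens takes input $A$, and Ker_basis takes input $B$. **Reduction (LW).** A partial map $\rho$ from row indices to column indices is maintained, initially empty. Reducing column $j$ means: as long as column $j$ is nonzero with pivot $i$ and $\rho(i)=j'$ is defined with $j'<j$, add column $j'$ to column $j$. Afterwards column $j$ is marked visited, and if it is nonzero with pivot $i$, set $\rho(i)\leftarrow j$. **Min_gens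 (LW).** Traverse all grid cells $(x,y)\in\{1,\dots,X\}\times\{1,\dots,Y\}$ in lexicographic order ($x$ first, then $y$). At $(x,y)$: go through the columns with grade $(1,y),(2,y),\dots,(x-1,y)$ in that order and reduce them; then go through the columns with grade $(x,y)$ and reduce them; every column of grade $(x,y)$ not reducing to $0$ is appended (in its reduced form) to the output matrix with grade $(x,y)$. **Ker_basis (LW).** Each column $j$ has an auxiliary vector, initially the unit vector $e_j$; whenever column $j'$ is added to column $j$, the auxiliary vector of $j'$ is added to that of $j$. Traverse all grid cells in lexicographic order. At $(x,y)$: go through the columns with grade $(1,y),\dots,(x,y)$ in that order and reduce them; if a column turns from nonzero to zero during its reduction, append its auxiliary vector to the output matrix with grade $(x,y)$. Rows of the output inherit the grades of the columns of $B$. **Column-queue variants.** Two kinds of priority queues are used. (1) A grade queue of grades in lexicographic order, initialized with the column grades of the matrix; each grade present in it is handled once. The algorithm keeps popping the smallest grade from it until it is empty. (2) For each $y$-coordinate $y_0$ occurring among the column grades, a priority queue $Q_{y_0}$ of column indices (smallest index first), initially empty. Extended reduction: if at current grade $(x,y)$ the reduction of column $i$ stops because column $i$ is nonzero with pivot $j$ and $\rho(j)=k$ is defined with $k>i$, then, besides setting $\rho(j)\leftarrow i$, let $y'$ be the $y$-coordinate of the grade of column $k$ (necessarily $y'\ge y$); push $k$ to $Q_{y'}$ and, if $y'>y$, push $(x,y')$ to the grade queue. Handling a popped grade $(x,y)$: instead of scanning through all columns of grade $(1,y),\dots,(x-1,y)$, keep popping the smallest index from $Q_y$ and reduce the corresponding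 column (this may push further indices to $Q_y$), until $Q_y$ is empty; then proceed with the columns of grade $(x,y)$ as in the LW variant. Output columns are appended under the same conditions as in the LW variants: in Min_gens, the columns of grade $(x,y)$ that do not reduce to zero; in Ker_basis, the auxiliary vectors of all columns that turn from nonzero to zero while being reduced at $(x,y)$, with grade $(x,y)$. *)

(* Defs.v *)
From HB Require Import structures.
From mathcomp Require Import all_boot all_order all_algebra.

Set Implicit Arguments.
Unset Strict Implicit.
Unset Printing Implicit Defensive.

Import Order.TTheory GRing.Theory Num.Theory.
Local Open Scope ring_scope.

(* Grades (x, y) in Z^2, with the product, lexicographic (x first) and
   co-lexicographic (y first) orders. *)
Definition grade : Type := (int * int)%type.

Definition grade_le (u v : int *p int) : bool := (u <= v)%O.
Definition lex_le (u v : int *l int) : bool := (u <= v)%O.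
Definition colex_le (u v : grade) : bool := lex_le (u.2, u.1) (v.2, v.1).

Record gmatrix (m n : nat) := GMatrix {
  entries : 'M['F_2]_(m, n);
  rgrade : 'I_m -> grade;
  cgrade : 'I_n -> grade
}.

(* The graded matrices that represent a morphism of free persistence modules
   (images of the basis elements in the columns): a basis element of grade v
   can only be mapped to a combination of basis elements of grade <= v. *)
Definition homogeneous m n (M : gmatrix m n) : Prop :=
  forall i j, entries M i j != 0 -> grade_le (rgrade M i) (cgrade M j).

Definition colex_sorted n (g : 'I_n -> grade) : Prop :=
  forall i j : 'I_n, (i <= j)%N -> colex_le (g i) (g j).

(* F^2 --A--> F^1 --B--> F^0, the rows of A and the columns of B being indexed
   by the same ordered homogeneous basis of F^1. *)
Definition short_chain_complex n0 n1 n2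
    (A : gmatrix n1 n2) (B : gmatrix n0 n1) : Prop :=
  [/\ rgrade A =1 cgrade B, homogeneous A, homogeneous B
    & entries B *m entries A = 0].

Definition in_grid (X Y : nat) n (g : 'I_n -> grade) : Prop :=
  forall j, (1 <= (g j).1 <= X%:Z) && (1 <= (g j).2 <= Y%:Z).

Definition pivot m n (M : 'M['F_2]_(m, n)) (j : 'I_n) : option 'I_m :=
  [pick i | (M i j != 0) && [forall i', (M i' j != 0) ==> (i' <= i)%N]].

Definition add_col m n (j' j : 'I_n) (M : 'M['F_2]_(m, n)) : 'M['F_2]_(m, n) :=
  \matrix_(i, k) (if k == j then M i k + M i j' else M i k).

(* Column j of [aux] is the auxiliary vector of column j.  It is maintained in
   both algorithms, but Min_gens never reads it. *)
Record state m n := State {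
  mat : 'M['F_2]_(m, n);
  aux : 'M['F_2]_n;
  rho : {ffun 'I_m -> option 'I_n}
}.

Definition init_state m n (M : 'M['F_2]_(m, n)) : state m n :=
  State M 1%:M [ffun=> None].

Section Reduction.
Context (m n : nat).
Implicit Types (s t : state m n) (i j k : 'I_n).

(* The value of rho at the pivot of column j. *)
Definition rho_pivot s j : option 'I_n := obind (rho s) (pivot (mat s) j).

(* The column that the reduction of column j adds next, if any. *)
Definition addend s j : option 'I_n :=
  if rho_pivot s j is Some j' then if (j' < j)%N then Some j' else None
  else None.

(* The column that loses its pivot to column i when the reduction of column i
   stops in state s, if any. *)
Definition displaced s i : option 'I_n :=
  if rho_pivot s i is Some k then if (i < k)%N then Some k else None
  else None.

Definition state_add j' j s : state m n :=
  State (add_col j' j (mat s)) (add_col j' j (aux s)) (rho s).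

(* The while loop of the reduction of column j; being a relation, it does not
   presuppose termination. *)
Inductive additions j : state m n -> state m n -> Prop :=
| additions_stop s : addend s j = None -> additions j s s
| additions_step s t j' : addend s j = Some j' ->
    additions j (state_add j' j s) t -> additions j s t.

(* rho(i) <- j if column j is nonzero with pivot i. *)
Definition set_rho j s : state m n :=
  if pivot (mat s) j is Some i
  then State (mat s) (aux s)
         [ffun i' => if i' == i then Some j else rho s i']
  else s.

End Reduction.

Inductive for_each (I S : Type) (body : I -> S -> S -> Prop) :
    seq I -> S -> S -> Prop :=
| for_each_nil c : for_each body [::] c c
| for_each_cons i l c d e : body i c d -> for_each body l d e ->
    for_each body (i :: l) c e.

(* The vector, if any, to be appended to the output when the reduction of
   column j takes state s to state t.  The boolean tells whether column j is
   visited as one of the columns of the current grade (x, y), as opposed to one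
   of the columns of grade (x', y) with x' < x. *)
Definition reporter (m n p : nat) : Type :=
  bool -> 'I_n -> state m n -> state m n -> option 'cV['F_2]_p.

Definition min_gens_report m n : reporter m n m := fun current j s t =>
  if current && (col j (mat t) != 0) then Some (col j (mat t)) else None.

Definition ker_basis_report m n : reporter m n n := fun _ j s t =>
  if (col j (mat s) != 0) && (col j (mat t) == 0)
  then Some (col j (aux t)) else None.

Definition out_columns (p : nat) : Type := seq ('cV['F_2]_p * grade).

Definition append p (v : option 'cV['F_2]_p) (z : grade) (o : out_columns p) :
    out_columns p :=
  if v is Some c then rcons o (c, z) else o.

Definition out_matrix p (r : 'I_p -> grade) (o : out_columns p) :
    {c : nat & gmatrix p c} :=
  Tagged (gmatrix p)
    (GMatrix (\matrix_(i < p, j < size o) (tnth (in_tuple o) j).1 i 0) r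
             (fun j : 'I_(size o) => (tnth (in_tuple o) j).2)).

Section Algorithms.
Context (m n p : nat) (g : 'I_n -> grade) (report : reporter m n p).

Definition columns_of_grade (z : grade) : seq 'I_n :=
  [seq j <- enum 'I_n | g j == z].

(* Columns of grade (1, y), ..., (x - 1, y), in that order. *)
Definition columns_left_of (x y : nat) : seq 'I_n :=
  flatten [seq columns_of_grade (x'%:Z, y%:Z) | x' <- iota 1 (x - 1)].

Definition lwconf : Type := (state m n * out_columns p)%type.

Definition lw_visit (current : bool) (z : grade) (j : 'I_n) (c d : lwconf) :
    Prop :=
  exists2 t, additions j c.1 t &
    d = (set_rho j t, append (report current j c.1 (set_rho j t)) z c.2).

Definition lw_cell (xy : nat * nat) (c d : lwconf) : Prop :=
  let z : grade := (xy.1%:Z, xy.2%:Z) in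
  exists2 e, for_each (lw_visit false z) (columns_left_of xy.1 xy.2) c e &
             for_each (lw_visit true z) (columns_of_grade z) e d.

Definition lw_run (X Y : nat) : lwconf -> lwconf -> Prop :=
  for_each lw_cell [seq (x, y) | x <- iota 1 X, y <- iota 1 Y].

(* Priority queues are sorted sequences, popped at the head.  [gqueue] is the
   grade queue, without duplicates; [cqueue y] is the queue Q_y. *)
Record qconf := QConf {
  base : lwconf;
  gqueue : seq grade;
  cqueue : int -> seq 'I_n
}.

Definition set_gqueue (G : seq grade) (c : qconf) : qconf :=
  QConf (base c) G (cqueue c).

Definition set_cqueue (y : int) (Q : seq 'I_n) (c : qconf) : qconf :=
  QConf (base c) (gqueue c) (fun y0 => if y0 == y then Q else cqueue c y0).

Definition grade_queue (G : seq grade) : seq grade := sort lex_le (undup G).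

Definition push_grade (z : grade) (c : qconf) : qconf :=
  set_gqueue (grade_queue (z :: gqueue c)) c.

Definition push_column (y : int) (k : 'I_n) (c : qconf) : qconf :=
  set_cqueue y (sort (fun a b : 'I_n => (a <= b)%N) (k :: cqueue c y)) c.

Definition push_displaced (z : grade) (k : option 'I_n) (c : qconf) : qconf :=
  if k is Some k then
    let y' := (g k).2 in
    let c' := push_column y' k c in
    if z.2 < y' then push_grade (z.1, y') c' else c'
  else c.

Definition queue_visit (current : bool) (z : grade) (j : 'I_n) (c d : qconf) :
    Prop :=
  let: (s, o) := base c in
  exists2 t, additions j s t &
    d = push_displaced z (displaced t j)
          (QConf (set_rho j t, append (report current j s (set_rho j t)) z o)
                 (gqueue c) (cqueue c)).

Inductive drain (z : grade) : qconf -> qconf -> Prop :=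
| drain_empty c : cqueue c z.2 = [::] -> drain z c c
| drain_pop c d e j Q : cqueue c z.2 = j :: Q ->
    queue_visit false z j (set_cqueue z.2 Q c) d -> drain z d e -> drain z c e.

Definition queue_cell (z : grade) (c d : qconf) : Prop :=
  exists2 e, drain z c e & for_each (queue_visit true z) (columns_of_grade z) e d.

Inductive queue_run : qconf -> qconf -> Prop :=
| queue_run_empty c : gqueue c = [::] -> queue_run c c
| queue_run_pop c d e z G : gqueue c = z :: G ->
    queue_cell z (set_gqueue G c) d -> queue_run d e -> queue_run c e.

Definition init_queues (c : lwconf) : qconf :=
  QConf c (grade_queue (codom g)) (fun=> [::]).

End Algorithms.

(* [lw_output report r X Y M D], resp. [queue_output report r M D]: on input M
   the algorithm terminates with output the graded matrix D, whose rows have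
   grades r. *)
Definition lw_output m n p (report : reporter m n p) (r : 'I_p -> grade)
    (X Y : nat) (M : gmatrix m n) (D : {c : nat & gmatrix p c}) : Prop :=
  exists2 c, lw_run (cgrade M) report X Y (init_state (entries M), [::]) c &
             D = out_matrix r c.2.

Definition queue_output m n p (report : reporter m n p) (r : 'I_p -> grade)
    (M : gmatrix m n) (D : {c : nat & gmatrix p c}) : Prop :=
  exists2 c, queue_run (cgrade M) report
               (init_queues (cgrade M) (init_state (entries M), [::])) c &
             D = out_matrix r (base c).2.

Definition min_gens_lw m n (X Y : nat) (M : gmatrix m n) :=
  lw_output (@min_gens_report m n) (rgrade M) X Y M.

Definition min_gens_queue m n (M : gmatrix m n) :=
  queue_output (@min_gens_report m n) (rgrade M) M.

Definition ker_basis_lw m n (X Y : nat) (M : gmatrix m n) :=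
  lw_output (@ker_basis_report m n) (cgrade M) X Y M.

Definition ker_basis_queue m n (M : gmatrix m n) :=
  queue_output (@ker_basis_report m n) (cgrade M) M.

(* Main.v *)
(* A visited column is settled if it is zero or still owns its pivot under rho.
   Reducing a settled column changes nothing, and reducing column j settles j
   and unsettles at most one column, the one displaced from its pivot.  The
   queue Q_y always holds exactly the unsettled visited columns of y-grade y,
   and the grade queue the grades of the unvisited columns together with the
   next cell at which each unsettled column is due.  Hence the queue variants
   skip only the idle reductions of the LW variants. *)

Require Import Defs.
From mathcomp Require Import all_boot all_order all_algebra.
From mathcomp Require Import zify.

Set Implicit Arguments.
Unset Strict Implicit.
Unset Printing Implicit Defensive.

Import Order.TTheory GRing.Theory Num.Theory.
Local Open Scope ring_scope.

(** * Determinism of the relations that model the two algorithms *)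

Section Relations.

Lemma additions_fun m n (j : 'I_n) (s t t' : state m n) :
  additions j s t -> additions j s t' -> t = t'.
Proof.
move=> st; elim: st t' => [s0 e|s0 t0 j' e _ IH] t' st'.
  by case: st' e => // s1 t1 j1 ->.
case: st' e IH => [s1 ->//|s1 t1 j1 -> st1 [<-] IH]; exact: IH.
Qed.

Lemma for_each_fun I S (body : I -> S -> S -> Prop) :
  (forall i c d d', body i c d -> body i c d' -> d = d') ->
  forall l c d d', for_each body l c d -> for_each body l c d' -> d = d'.
Proof.
move=> fun_body l c d d' cd; elim: cd d' => [c0|i l0 c0 d0 e cd0 _ IH] d' H.
  by inversion H.
by inversion H as [|i1 l1 c1 d1 e1 cd1 de1]; subst; apply: IH;
  rewrite (fun_body _ _ _ _ cd0 cd1).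
Qed.

Lemma for_each_cat I S (body : I -> S -> S -> Prop) l1 l2 c d e :
  for_each body l1 c d -> for_each body l2 d e -> for_each body (l1 ++ l2) c e.
Proof.
by move=> cd; elim: cd e => //= i l c0 d0 e0 cd0 _ IH e de;
  apply: for_each_cons cd0 (IH _ de).
Qed.

Lemma for_each_stutter (I : eqType) S (body : I -> S -> S -> Prop) l c :
  {in l, forall i, body i c c} -> for_each body l c c.
Proof.
elim: l => [|i l IH] cc; first exact: for_each_nil.
apply: (for_each_cons (cc i (mem_head _ _))); apply: IH => k lk.
by apply: cc; rewrite inE lk orbT.
Qed.

Variables (m n p : nat) (g : 'I_n -> grade) (report : reporter m n p).

Lemma lw_visit_fun b z j c d d' :
  lw_visit report b z j c d -> lw_visit report b z j c d' -> d = d'.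
Proof. by move=> [t ct ->] [t' /(additions_fun ct) <- ->]. Qed.

Lemma lw_run_fun X Y c d d' :
  lw_run g report X Y c d -> lw_run g report X Y c d' -> d = d'.
Proof.
apply: for_each_fun => xy c0 d0 d0' [e ce ed] [e' ce' ed'].
have := for_each_fun (@lw_visit_fun false _) ce ce' => ee'; subst e'.
exact: for_each_fun (@lw_visit_fun true _) _ _ _ _ ed ed'.
Qed.

Lemma queue_visit_fun b z j c d d' :
  queue_visit g report b z j c d -> queue_visit g report b z j c d' -> d = d'.
Proof.
by case: c => [[s o] G Q] [t ct ->] [t' /(additions_fun ct) <- ->].
Qed.

Lemma drain_fun z c d d' :
  drain g report z c d -> drain g report z c d' -> d = d'.
Proof.
move=> cd; elim: cd d' => [c0 e|c0 d0 e0 j Q e cd0 _ IH] d' H;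
  inversion H as [c1 e1|c1 d1 e1 j1 Q1 e1' cd1 de1]; subst => //.
- by rewrite e in e1'.
- by rewrite e in e1.
- move: e1'; rewrite e => -[jj QQ]; subst.
  by apply: IH; rewrite (queue_visit_fun cd0 cd1).
Qed.

Lemma queue_run_fun c d d' :
  queue_run g report c d -> queue_run g report c d' -> d = d'.
Proof.
move=> cd; elim: cd d' => [c0 e|c0 d0 e0 z G e [a ca ad] _ IH] d' H;
  inversion H as [c1 e1|c1 d1 e1 z1 G1 e1' [a1 ca1 ad1] de1]; subst => //.
- by rewrite e in e1'.
- by rewrite e in e1.
- move: e1'; rewrite e => -[zz GG]; subst.
  have aa := drain_fun ca ca1; subst a1.
  by apply: IH; rewrite (for_each_fun (@queue_visit_fun true _) ad ad1).
Qed.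

End Relations.

(** * Pivots, termination of the reduction, settled columns *)

Section Pivots.
Variables (m n : nat).
Implicit Types (M : 'M['F_2]_(m, n)) (s t : state m n).

Lemma pivotP M j i :
  reflect (M i j != 0 /\ forall i', M i' j != 0 -> (i' <= i)%N)
          (pivot M j == Some i).
Proof.
rewrite /pivot; case: pickP => [k /andP[Mk /forallP max_k]|no_pivot].
  apply: (iffP eqP) => [[<-]|[Mi max_i]].
    by split=> // i'; apply: (implyP (max_k i')).
  congr Some; apply: val_inj; apply/eqP; rewrite eqn_leq max_i //=.
  exact: (implyP (max_k i)).
apply: (iffP idP) => // -[Mi max_i].
move: (no_pivot i); rewrite Mi /=.
by move/negbT/forallPn => [i']; rewrite negb_imply => /andP[/max_i ->].
Qed.

Lemma eq_pivot M M' j : (forall i, M i j = M' i j) -> pivot M j = pivot M' j.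
Proof.
move=> eqM; apply: eq_pick => i /=; rewrite eqM; congr (_ && _).
by apply: eq_forallb => i'; rewrite eqM.
Qed.

Lemma pivot_add_col_neq M j' j k :
  k != j -> pivot (add_col j' j M) k = pivot M k.
Proof.
by move=> neq; apply: eq_pivot => i; rewrite mxE (negbTE neq).
Qed.

Lemma F2_neq0 (x : 'F_2) : x != 0 -> x = 1.
Proof. by case: x => [[|[|x]] lt_x] //= _; apply: val_inj. Qed.

(** Both columns vanish in all rows past [i], and their entries in row [i] are 1, which cancel over
    ['F_2]. *)
Lemma pivot_add_col M j' j i i1 : pivot M j = Some i -> pivot M j' = Some i ->
  pivot (add_col j' j M) j = Some i1 -> (i1 < i)%N.
Proof.
move=> /eqP/pivotP[Mj max_j] /eqP/pivotP[Mj' max_j'] /eqP/pivotP[].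
rewrite mxE eqxx => ne0 _; rewrite ltn_neqAle; apply/andP; split.
  apply: contraNneq ne0 => /val_inj ->.
  by rewrite (F2_neq0 Mj) (F2_neq0 Mj'); apply/eqP/val_inj.
have [z|/max_j//] := eqVneq (M i1 j) 0.
by apply: max_j'; move: ne0; rewrite z add0r.
Qed.

Definition rho_sound s : Prop :=
  forall i j, rho s i = Some j -> pivot (mat s) j = Some i.

Definition settled s k : bool :=
  if pivot (mat s) k is Some i then rho s i == Some k else true.

Lemma addendP s j j' : addend s j = Some j' ->
  exists i, [/\ pivot (mat s) j = Some i, rho s i = Some j' & (j' < j)%N].
Proof.
rewrite /addend /rho_pivot; case: pivot => //= i.
by case rho_i: (rho s i) => [k|] //; case: ifP => // lt [<-]; exists i.
Qed.

(** Only column [j] changes, and [rho] does not register it: soundness would place it at its own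
    pivot, where [j' < j] is registered. *)
Lemma rho_sound_add s j j' : rho_sound s -> addend s j = Some j' ->
  rho_sound (state_add j' j s).
Proof.
move=> sound /addendP[i [piv_j rho_i lt]] i1 k /= rho_k.
rewrite pivot_add_col_neq; first exact: sound.
apply/negP => /eqP e; subst k.
move: (sound _ _ rho_k) lt; rewrite piv_j => -[ii]; subst i1.
by move: rho_k; rewrite rho_i => -[->]; rewrite ltnn.
Qed.

(** By soundness the added column shares the pivot of column [j], so each addition strictly lowers
    [height], which is 0 for a zero column. *)
Lemma additions_exist s j : rho_sound s -> exists t, additions j s t.
Proof.
pose height s : nat := if pivot (mat s) j is Some i then i.+1 else 0.
have [N] := ubnP (height s); elim: N s => // N IH s ltN sound.
case add_j: (addend s j) => [j'|]; last by exists s; apply: additions_stop.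
have [i [piv_j rho_i lt]] := addendP add_j.
have [|t st] := IH _ _ (rho_sound_add sound add_j).
  rewrite ltnS in ltN; apply: leq_trans ltN; rewrite /height piv_j /=.
  case piv1: pivot => [i1|//]; rewrite ltnS.
  exact: pivot_add_col piv_j (sound _ _ rho_i) piv1.
by exists t; apply: additions_step st.
Qed.

Lemma additionsP s t j : rho_sound s -> additions j s t ->
  [/\ rho_sound t, addend t j = None, rho t = rho s &
      forall k, k != j -> pivot (mat t) k = pivot (mat s) k].
Proof.
move=> sound st; elim: st sound => [s0 e sound|s0 t0 j' add_j _ IH sound].
  by split.
have [soundt stop rho_t piv_t] := IH (rho_sound_add sound add_j).
split=> // k neq; rewrite piv_t //=; exact: pivot_add_col_neq.
Qed.

Lemma settled_addend s j : settled s j -> addend s j = None.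
Proof.
rewrite /settled /addend /rho_pivot; case: pivot => //= i /eqP ->.
by rewrite ltnn.
Qed.

Lemma settled_set_rho s j : settled s j -> set_rho j s = s.
Proof.
rewrite /settled /set_rho; case: s => M U r /=.
case: (pivot M j) => //= i /eqP ri.
by congr State; apply/ffunP => i'; rewrite ffunE; case: eqP => // ->.
Qed.

Lemma rho_sound_set_rho s j : rho_sound s -> rho_sound (set_rho j s).
Proof.
rewrite /set_rho; case piv_j: pivot => [i|//] sound i1 k /=.
by rewrite ffunE; case: eqP => [-> [<-]//|_]; apply: sound.
Qed.

Lemma rho_set_rho s j i k :
  rho (set_rho j s) i = Some k -> k = j \/ rho s i = Some k.
Proof.
rewrite /set_rho; case: pivot => [i1|] /=; last by right.
by rewrite ffunE; case: eqP => [_ [->]|]; [left|right].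
Qed.

Lemma displacedP t j k : displaced t j = Some k ->
  exists2 i, rho t i = Some k & (j < k)%N.
Proof.
rewrite /displaced /rho_pivot; case: pivot => //= i.
by case rho_i: (rho t i) => [k'|] //; case: ifP => // lt [<-]; exists i.
Qed.

(** [set_rho] rewrites [rho] only at the pivot row of column [j], so only the former owner of that
    row can become unsettled. *)
Lemma settled_visit s t j k : rho_sound s -> additions j s t ->
  settled (set_rho j t) k =
    (k == j) || settled s k && (displaced t j != Some k).
Proof.
move=> sound /(additionsP sound) [soundt stop rho_t piv_t].
have [->|neq] /= := eqVneq k j.
  rewrite /settled /set_rho; case piv_j: (pivot (mat t) j) => [i|] /=.
    by rewrite piv_j ffunE !eqxx.
  by rewrite piv_j.
have jk : (Some j == Some k) = false.
  by rewrite [_ == _](inj_eq Some_inj) eq_sym (negbTE neq).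
have -> : settled s k = settled t k by rewrite /settled rho_t piv_t.
move: stop; rewrite /settled /set_rho /addend /displaced /rho_pivot.
case piv_j: (pivot (mat t) j) => [i|] /=; last by rewrite andbT.
case piv_k: (pivot (mat t) k) => [i1|] /=.
  rewrite ffunE; have [->|neqi] := eqVneq i1 i.
    rewrite jk; case rho_i: (rho t i) => [k'|] //=.
    have [->|neqk] := eqVneq k' k; last first.
      by rewrite [Some k' == _](inj_eq Some_inj) (negbTE neqk).
    (* Here [k] owns the pivot row of [j]: for [j < k] it is the displaced column, and [k < j] would
       have kept the loop going. *)
    case: (ltnP j k) => [_ _|le]; first by rewrite eqxx.
    by have -> : (k < j)%N by rewrite ltn_neqAle le andbT; exact: neq.
  case rho_i: (rho t i) => [k'|] /=; last by rewrite andbT.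
  move=> _; case: ltnP => _; last by rewrite andbT.
  rewrite [Some k' == _](inj_eq Some_inj).
  have [ek|] := eqVneq k' k; last by rewrite andbT.
  subst k'; move: (soundt _ _ rho_i); rewrite piv_k => -[ee].
  by rewrite ee eqxx in neqi.
case rho_i: (rho t i) => [k'|] //= _; case: ltnP => // _.
rewrite (inj_eq Some_inj); case: eqVneq => // ee; subst k'.
by move: (soundt _ _ rho_i); rewrite piv_k.
Qed.

End Pivots.

(** * Lexicographic order, sorted queues, index ranges *)

Section Queues.

Lemma lex_leE (u v : grade) :
  lex_le u v = (u.1 < v.1) || ((u.1 == v.1) && (u.2 <= v.2)).
Proof.
by case: u v => [a b] [c d]; rewrite /lex_le /= lexi_pair; lia.
Qed.

Lemma grade_eqE (u v : grade) : (u == v) = (u.1 == v.1) && (u.2 == v.2).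
Proof. by case: u v. Qed.

Lemma lex_le_total : total lex_le.
Proof. by move=> u v; rewrite !lex_leE; lia. Qed.

Lemma lex_le_trans : transitive lex_le.
Proof. by move=> u v w; rewrite !lex_leE; lia. Qed.

Lemma lex_le_anti : antisymmetric lex_le.
Proof.
by move=> u v; rewrite !lex_leE => H; apply/eqP; rewrite grade_eqE; lia.
Qed.

Lemma mem_grade_queue G : grade_queue G =i G.
Proof. by move=> u; rewrite mem_sort mem_undup. Qed.

Lemma grade_queue_uniq G : uniq (grade_queue G).
Proof. by rewrite sort_uniq undup_uniq. Qed.

Lemma grade_queue_sorted G : sorted lex_le (grade_queue G).
Proof. exact: sort_sorted lex_le_total _. Qed.

Variable n : nat.

Let leo (a b : 'I_n) := (a <= b)%N.

Lemma leo_trans : transitive leo.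
Proof. by move=> a b c; apply: leq_trans. Qed.

Lemma leo_anti : antisymmetric leo.
Proof. by move=> a b ab; apply/val_inj/anti_leq. Qed.

Lemma sorted_enum_ord : sorted leo (enum 'I_n).
Proof.
by have := iota_sorted 0 n; rewrite -val_enum_ord sorted_map.
Qed.

(** Models a push: column queues are described as increasing lists of the indices satisfying a
    predicate. *)
Lemma sort_filter_enum (P Q : pred 'I_n) k : ~~ P k -> Q =1 predU1 k P ->
  sort leo (k :: filter P (enum 'I_n)) = filter Q (enum 'I_n).
Proof.
move=> nPk QP; apply: (sorted_eq leo_trans leo_anti).
- by apply: sort_sorted => a b; apply: leq_total.
- exact: sorted_filter leo_trans _ _ sorted_enum_ord.
rewrite perm_sort; apply: uniq_perm => [||i] /=.
- by rewrite filter_uniq ?enum_uniq // mem_filter (negbTE nPk).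
- by rewrite filter_uniq ?enum_uniq.
by rewrite in_cons (mem_filter P) (mem_filter Q) mem_enum !andbT QP.
Qed.

Lemma cat_filter_enum (P Q : pred 'I_n) :
  (forall i j, P i -> Q j -> (i < j)%N) ->
  filter P (enum 'I_n) ++ filter Q (enum 'I_n) =
    filter (predU P Q) (enum 'I_n).
Proof.
move=> PQ; apply: (sorted_eq leo_trans leo_anti).
- rewrite (sorted_pairwise leo_trans) pairwise_cat.
  rewrite -!(sorted_pairwise leo_trans).
  rewrite (sorted_filter leo_trans P sorted_enum_ord).
  rewrite (sorted_filter leo_trans Q sorted_enum_ord) !andbT.
  apply/allrelP => i j; rewrite (mem_filter P) (mem_filter Q).
  move=> /andP[Pi _] /andP[Qj _].
  exact: ltnW (PQ _ _ Pi Qj).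
- exact: sorted_filter leo_trans _ _ sorted_enum_ord.
apply: uniq_perm => [||i].
- rewrite cat_uniq (filter_uniq P (enum_uniq _)).
  rewrite (filter_uniq Q (enum_uniq _)) andbT /=.
  apply/hasPn => i; rewrite (mem_filter P) (mem_filter Q) => /andP[Qi _].
  by apply/negP => /andP[Pi _]; have := PQ _ _ Pi Qi; rewrite ltnn.
- exact: filter_uniq (enum_uniq _).
rewrite mem_cat (mem_filter P) (mem_filter Q) (mem_filter (predU P Q)).
by rewrite mem_enum !andbT.
Qed.

Lemma drop_enum_ord (a : 'I_n) : drop a (enum 'I_n) = a :: drop a.+1 (enum 'I_n).
Proof. by rewrite (drop_nth a) ?size_enum_ord // nth_ord_enum. Qed.

Lemma filter_drop_enum (P : pred 'I_n) a : (forall k, P k -> (a <= k)%N) ->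
  filter P (enum 'I_n) = filter P (drop a (enum 'I_n)).
Proof.
move=> Pa; rewrite -{1}(cat_take_drop a (enum 'I_n)) filter_cat.
rewrite (_ : [seq k <- take a _ | P k] = [::]) //.
apply/eqP; rewrite -[_ == _]negbK -has_filter; apply/hasPn => k.
rewrite -(mem_map val_inj) map_take val_enum_ord take_iota mem_iota => lt.
apply/negP => /Pa le; move: lt.
by rewrite add0n /= ltn_min; move: le; rewrite leqNgt => /negbTE ->.
Qed.

End Queues.

(** * The invariant and its preservation by a single visit *)

Section Simulation.
Variables (X Y m n p : nat) (g : 'I_n -> grade) (report : reporter m n p).
Hypotheses (sorted_g : colex_sorted g) (grid_g : in_grid X Y g).
Hypothesis report_idle : forall j s, report false j s s = None.

Lemma sorted_gE (j k : 'I_n) : (j <= k)%N ->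
  ((g j).2 < (g k).2) || ((g j).2 == (g k).2) && ((g j).1 <= (g k).1).
Proof. by move/sorted_g; rewrite /colex_le lex_leE. Qed.

(* [w] is a lower bound on the grades still to be handled, [V] holds of the
   columns visited so far except one just popped from its queue, and [R] bounds
   the unsettled columns still to be popped at the current grade. *)
Record queue_inv (w : grade) (V R : pred 'I_n) (c : qconf m n p) : Prop := {
  inv_sound : rho_sound (base c).1;
  inv_rho : forall i k, rho (base c).1 i = Some k -> V k;
  inv_cqueue : forall y, cqueue c y =
    [seq k <- enum 'I_n | [&& (g k).2 == y, V k & ~~ settled (base c).1 k]];
  inv_sorted : sorted lex_le (gqueue c);
  inv_uniq : uniq (gqueue c);
  inv_box : forall u, u \in gqueue c ->
    [&& 1 <= u.1 <= X%:Z, 1 <= u.2 <= Y%:Z & lex_le w u];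
  inv_fresh : forall k, lex_le w (g k) -> g k \in gqueue c;
  inv_pending : forall k, V k -> ~~ settled (base c).1 k ->
    (w.2 <= (g k).2) && ((w.1, (g k).2) \in gqueue c) || R k
}.

Lemma eq_queue_inv w V V' R c :
  V =1 V' -> queue_inv w V R c -> queue_inv w V' R c.
Proof.
move=> eqV [? rhoV cqV ? ? ? ? pendV]; split=> //.
- by move=> i k /rhoV; rewrite eqV.
- by move=> y; rewrite cqV; apply: eq_filter => k; rewrite eqV.
- by move=> k; rewrite -eqV; apply: pendV.
Qed.

(** Both variants perform the same reduction, so only the bookkeeping is at stake. Column [j] is
    fresh or just popped, hence outside [V]; the bound is the cell after [z], since [z] has left the
    grade queue. *)
Lemma visit_queue_inv b (z : grade) V (R R' : pred 'I_n) j c :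
    queue_inv (z.1, z.2 + 1) V R c -> 1 <= z.1 <= X%:Z ->
    (g j).2 = z.2 -> ~~ V j ->
    (forall k, k != j -> V k -> R k -> R' k) ->
    (forall k, V k -> (j < k)%N -> (g k).2 = z.2 -> R' k) ->
  exists d, [/\ queue_visit g report b z j c d,
    lw_visit report b z j (base c) (base d) &
    queue_inv (z.1, z.2 + 1) (predU1 j V) R' d].
Proof.
case: c => [[s o] G Q] [/= sound rhoV cq srt unq box fresh pend] zX gj nVj RR' VR'.
have [t st] := additions_exist j sound.
have [soundt _ rho_t _] := additionsP sound st.
have settledE k := settled_visit k sound st.
pose c' : qconf m n p := QConf (set_rho j t, append (report b j s (set_rho j t)) z o) G Q.
pose d := push_displaced g z (displaced t j) c'.
have base_d : base d = base c'.
  by rewrite /d; case: displaced => //= k; case: ifP.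
exists d; split; [by exists t | by exists t; rewrite ?base_d |].
(* A displaced column was registered in [rho], hence visited and settled so far; its index exceeds
   [j], so the co-lexicographic order bounds its y-grade below by [z.2]. *)
have dispP k : displaced t j = Some k ->
  [/\ V k, (j < k)%N, settled s k & z.2 <= (g k).2].
  move=> /displacedP[i]; rewrite rho_t => rho_i jk; split=> //.
  - exact: rhoV rho_i.
  - by rewrite /settled (sound _ _ rho_i) rho_i.
  - by have := sorted_gE (ltnW jk); rewrite gj; lia.
have gq u : u \in gqueue d = (u \in G) ||
    (if displaced t j is Some k then (z.2 < (g k).2) && (u == (z.1, (g k).2))
     else false).
  rewrite /d; case: displaced => [k|] /=; last by rewrite orbF.
  case: ifP => _ /=; last by rewrite orbF.
  by rewrite mem_grade_queue inE orbC.
split; rewrite ?base_d /=.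
- exact: rho_sound_set_rho.
- by move=> i k /rho_set_rho[->|]; rewrite ?eqxx // rho_t => /rhoV ->; rewrite orbT.
- move=> y.
  have -> : cqueue d y = if displaced t j is Some k then
      if y == (g k).2 then sort (fun a b : 'I_n => (a <= b)%N) (k :: Q y)
      else Q y else Q y.
    rewrite /d; case: displaced => [k|] //=.
    by case: ifP => _ /=; case: eqP => // ->.
  have eqQ : (forall k, displaced t j = Some k -> (g k).2 != y) ->
      Q y = [seq k <- enum 'I_n | [&& (g k).2 == y, predU1 j V k
                                    & ~~ settled (set_rho j t) k]].
    move=> ny; rewrite cq; apply: eq_filter => k /=; rewrite settledE.
    have [->|neq] /= := eqVneq k j; first by rewrite (negbTE nVj) andbF.
    case: eqP => //= gk; congr (_ && ~~ _).
    have [dk|_] := eqVneq (displaced t j) (Some k); last by rewrite andbT.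
    by have := ny _ dk; rewrite gk eqxx.
  case dk: (displaced t j) => [k|]; last by apply: eqQ; rewrite dk.
  have [Vk jk set_k zk] := dispP _ dk.
  have [yk|ny] := eqVneq y (g k).2; last first.
    by apply: eqQ => k'; rewrite dk => -[<-]; rewrite eq_sym.
  rewrite cq; apply: sort_filter_enum; first by rewrite set_k !andbF.
  move=> i /=; rewrite settledE dk [Some k == _](inj_eq Some_inj).
  have [->|nij] /= := eqVneq i j.
    rewrite (negbTE nVj) !andbF orbF; apply/esym/negP => /eqP ee.
    by move: jk; rewrite ee ltnn.
  have [->|nik] /= := eqVneq i k; first by rewrite yk eqxx Vk andbF.
  by rewrite andbT.
- rewrite /d; case: displaced => [k|] //=; case: ifP => // _ /=.
  exact: grade_queue_sorted.
- rewrite /d; case: displaced => [k|] //=; case: ifP => // _ /=.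
  exact: grade_queue_uniq.
- move=> u; rewrite gq => /orP[/box//|].
  case dk: (displaced t j) => [k|//] /andP[zk /eqP ->] /=.
  by move: (grid_g k) zk zX; rewrite lex_leE /=; lia.
- by move=> k /fresh; rewrite gq => ->.
- move=> k; rewrite settledE gq.
  have [->|neq] //= := eqVneq k j; move=> Vk.
  rewrite negb_and => /orP[uns|].
    by case/orP: (pend k Vk uns) => [/andP[-> ->]//|/(RR' _ neq Vk) ->]; rewrite orbT.
  rewrite negbK => /eqP dk; rewrite dk eqxx andbT.
  have [_ jk _ zk] := dispP _ dk.
  (* The displaced column is due at the pushed grade if its y-grade is larger, and otherwise in the
     current queue, as [R'] allows. *)
  case: (ltrP z.2 (g k).2) => lt; first by rewrite orbT andbT (_ : _ <= _) //; lia.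
  by rewrite (VR' _ Vk jk) ?orbT //; lia.
Qed.

(** For fixed y the co-lexicographic order makes x grow with the index, so the LW scan runs in index
    order, the order in which a column queue is popped. *)
Lemma columns_left_ofE (x y : nat) : (0 < x)%N ->
  columns_left_of g x y =
    [seq k <- enum 'I_n | ((g k).2 == y%:Z) && ((g k).1 < x%:Z)].
Proof.
case: x => // r _; rewrite /columns_left_of subn1 succnK.
elim: r => [|r IH].
  rewrite /= -(filter_pred0 (enum 'I_n)); apply: eq_filter => k /=.
  by have := grid_g k; lia.
rewrite -(addn1 r) iotaD map_cat flatten_cat IH /= cats0 add1n.
rewrite cat_filter_enum; last first.
  move=> i j /andP[iy ix] /eqP gj; rewrite ltnNge; apply/negP => /sorted_gE.
  by rewrite gj /=; move: iy ix; lia.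
by apply: eq_filter => k /=; rewrite grade_eqE /=; lia.
Qed.

Lemma lw_visit_settled z j (c : lwconf m n p) :
  settled c.1 j -> lw_visit report false z j c c.
Proof.
case: c => s o /= set_j; exists s.
  exact/additions_stop/settled_addend.
by rewrite (settled_set_rho set_j) report_idle.
Qed.

(** The popped column leaves [V] until its reduction puts it back, so that the queues still hold
    exactly the unsettled columns of [V]. *)
Lemma pop_queue_inv w V R y k Q c :
    queue_inv w V R c -> cqueue c y = k :: Q ->
  [/\ (g k).2 = y, V k, ~~ settled (base c).1 k &
      queue_inv w (predD1 V k) R (set_cqueue y Q c)].
Proof.
case=> sound rhoV cq srt unq box fresh pend cqy.
have := mem_head k Q; rewrite -cqy cq mem_filter => /andP[/and3P[/eqP gk Vk uns_k] _].
split=> //; split=> //=.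
(* Columns registered in a sound [rho] are settled, so [k] is not among them. *)
- move=> i l rho_i; rewrite (rhoV _ _ rho_i) andbT.
  by apply: contraNneq uns_k => <-; rewrite /settled (sound _ _ rho_i) rho_i.
- move=> y'; case: eqP => [->|ny].
    have Qk : k \notin Q.
      suff: uniq (k :: Q) by case/andP.
      by rewrite -cqy cq filter_uniq ?enum_uniq.
    have {1}-> : Q = filter (predC1 k) (k :: Q).
      rewrite /= eqxx; apply/esym/all_filterP/allP => i Qi.
      by apply: contraNneq Qk => <-.
    rewrite -cqy cq -filter_predI; apply: eq_filter => i /=.
    by rewrite andbCA; congr andb; rewrite andbA.
  rewrite cq; apply: eq_filter => i /=.
  by have [->|] := eqVneq i k; rewrite ?andbT // gk; case: eqP ny => // ->.
- by move=> l /andP[_ Vl]; apply: pend.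
Qed.

(** * Simulation of one cell *)

Definition before (z : grade) : pred 'I_n := fun k => ~~ lex_le z (g k).

(** The scan position [a] runs through all indices. If column [a] is in the queue, it is the head
    and both variants visit it; otherwise an LW visit to it is idle. Reductions displace only larger
    indices, so nothing is pushed behind the scan. *)
Lemma drain_sim (z : grade) a c : 1 <= z.1 <= X%:Z ->
    queue_inv (z.1, z.2 + 1) (before z)
      (fun k => ((g k).2 == z.2) && (a <= k)%N) c ->
  exists e, [/\ drain g report z c e,
    for_each (lw_visit report false z)
      [seq k <- drop a (enum 'I_n) | ((g k).2 == z.2) && ((g k).1 < z.1)]
      (base c) (base e) &
    queue_inv (z.1, z.2 + 1) (before z) pred0 e].
Proof.
move=> zX; have [N] := ubnP (n - a); elim: N a c => // N IH a c ltN inv.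
pose P k := [&& (g k).2 == z.2, before z k & ~~ settled (base c).1 k].
have cqP : cqueue c z.2 = filter P (drop a (enum 'I_n)).
  rewrite (inv_cqueue inv); apply: filter_drop_enum => k /and3P[gk Vk uns].
  (* A pending grade would require a y-grade of at least [z.2 + 1], so the bound [a <= k]
     applies. *)
  by have := inv_pending inv Vk uns; rewrite /= gk; move: gk; lia.
have [lt_an|le_na] := ltnP a n; last first.
  have drop0 : drop a (enum 'I_n) = [::] by rewrite drop_oversize ?size_enum_ord.
  exists c; split; [|by rewrite drop0; apply: for_each_nil|].
    by apply: drain_empty; rewrite cqP drop0.
  case: inv => ? ? ? ? ? ? ? pend; split=> // k Vk uns.
  case/orP: (pend k Vk uns) => [-> //|/andP[_ le]].
  by have := ltn_ord k; rewrite ltnNge (leq_trans le_na le).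
pose k := Ordinal lt_an.
have dropE := drop_enum_ord k; rewrite [nat_of_ord k]/= in dropE.
have ltN' : (n - a.+1 < N)%N by lia.
case Pk: (P k).
  have cqk : cqueue c z.2 = k :: filter P (drop a.+1 (enum 'I_n)).
    by rewrite cqP dropE /= Pk.
  have [gk Vk uns inv1] := pop_queue_inv inv cqk.
  have := visit_queue_inv false (R' := fun i => ((g i).2 == z.2) && (a.+1 <= i)%N)
    inv1 zX gk.
  case=> [|i ik _ /andP[-> le]|i _ ki ->|d [vis lw inv2]].
  - by rewrite /= eqxx.
  - by rewrite ltn_neqAle le andbT eq_sym; exact: ik.
  - by rewrite eqxx.
  have inv3 := eq_queue_inv (V' := before z) _ inv2.
  have {}inv3 := inv3 _; have [|e [dr lws inve]] := IH a.+1 d ltN'.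
    apply: inv3 => i; have [->|ne] := eqVneq i k.
      by rewrite Vk /= eqxx.
    by rewrite /= (negbTE ne).
  exists e; split=> //; first exact: drain_pop cqk vis dr.
  rewrite dropE /= -gk eqxx /=.
  (* A visited column with the y-grade of [z] has a smaller x-grade, so the LW scan lists it too. *)
  have -> /= : (g k).1 < z.1 by move: Vk; rewrite /before lex_leE gk; lia.
  by rewrite gk; apply: for_each_cons lw lws.
have [|e [dr lws inve]] := IH a.+1 c ltN'.
  case: inv => ? ? ? ? ? ? ? pend; split=> // i Vi uns.
  case/orP: (pend i Vi uns) => [-> //|/andP[gi le]].
  (* Index [a] itself is not in the queue, so the bound can be raised by one. *)
  rewrite /= gi ltn_neqAle le andbT orbC.
  have [ai|//] := eqVneq a i; move: Pk; rewrite /P.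
  have -> : k = i by apply: val_inj.
  by rewrite gi Vi uns.
exists e; split=> //; rewrite dropE /=; case: ifP => // /andP[gk xk].
apply: for_each_cons lws; apply: lw_visit_settled.
move: Pk; rewrite /P gk /before lex_leE.
have -> : ~~ ((z.1 < (g k).1) || (z.1 == (g k).1) && (z.2 <= (g k).2)) by lia.
by move/negbFE.
Qed.

(** Both variants visit the same columns; the point is that nothing is pushed to the already drained
    queue of the current y-grade, so [pred0] survives as bound. *)
Lemma current_sim (z : grade) a c : 1 <= z.1 <= X%:Z ->
    queue_inv (z.1, z.2 + 1)
      (fun k => before z k || ((g k == z) && (k < a)%N)) pred0 c ->
  exists e, [/\ for_each (queue_visit g report true z)
      [seq k <- drop a (enum 'I_n) | g k == z] c e,
    for_each (lw_visit report true z)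
      [seq k <- drop a (enum 'I_n) | g k == z] (base c) (base e) &
    queue_inv (z.1, z.2 + 1) (before (z.1, z.2 + 1)) pred0 e].
Proof.
move=> zX; have [N] := ubnP (n - a); elim: N a c => // N IH a c ltN inv.
have [lt_an|le_na] := ltnP a n; last first.
  rewrite drop_oversize ?size_enum_ord //.
  exists c; split; try exact: for_each_nil.
  apply: eq_queue_inv inv => k; rewrite (leq_trans (ltn_ord k) le_na) andbT.
  by rewrite /before !lex_leE grade_eqE /=; lia.
pose k := Ordinal lt_an.
have dropE := drop_enum_ord k; rewrite [nat_of_ord k]/= in dropE.
have ltN' : (n - a.+1 < N)%N by lia.
have ltS (i : 'I_n) : (i < a.+1)%N = (i == k) || (i < a)%N.
  by rewrite ltnS leq_eqVlt.
rewrite dropE /=; case: eqP => gk; last first.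
  apply: IH => //; apply: eq_queue_inv inv => i; rewrite ltS.
  have [->|_ //] := eqVneq i k.
  by move/eqP/negbTE: gk => ->.
have := visit_queue_inv true (R' := pred0) inv zX _ _ _ _ (j := k).
case=> [|||i|d [vis lw inv1]] //.
- by rewrite gk.
- by rewrite /before gk lex_leE /=; lia.
(* Columns of this y-grade with index above [k] have x-grade at least [z.1], and of those only
   columns with index below [k] have been visited. *)
- case/orP=> [|/andP[_ lt]]; last by rewrite ltnNge (ltnW lt).
  rewrite /before lex_leE => bef /ltnW /sorted_gE; rewrite gk => le gi.
  by move: bef le; rewrite gi; lia.
have [|e [qs lws inve]] := IH a.+1 d ltN'.
  apply: eq_queue_inv inv1 => i; rewrite ltS /predU1 [LHS]/=.
  by have [->|_ //] := eqVneq i k; rewrite gk eqxx orbT.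
by exists e; split=> //; [apply: for_each_cons vis qs|apply: for_each_cons lw lws].
Qed.

(** If [z] is queued, it is the head and both variants handle it. Otherwise the LW cell is idle and
    the queue variant makes no move. The queue run is stated by continuation because [queue_run] is
    built from its first pop. *)
Lemma cell_sim (x y : nat) c (z : grade := (x%:Z, y%:Z)) : (0 < x <= X)%N ->
    queue_inv z (before z) pred0 c ->
  exists e, [/\ lw_cell g report (x, y) (base c) (base e),
    forall d, queue_run g report e d -> queue_run g report c d &
    queue_inv (z.1, z.2 + 1) (before (z.1, z.2 + 1)) pred0 e].
Proof.
move=> xX inv.
have zX : 1 <= z.1 <= X%:Z by rewrite /z /=; lia.
have lexS (u : grade) : lex_le z u = (u == z) || lex_le (z.1, z.2 + 1) u.
  by rewrite !lex_leE grade_eqE /z /=; lia.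
have lexz : lex_le (z.1, z.2 + 1) z = false by rewrite lex_leE /=; lia.
have [|Gz] := boolP (z \in gqueue c).
  case Gc: (gqueue c) => [|h G] // zG.
  have hz : h = z.
    have /(inv_box inv)/and3P[_ _ zh] : h \in gqueue c by rewrite Gc mem_head.
    apply: lex_le_anti; rewrite zh andbT.
    move: zG; rewrite inE => /orP[/eqP->|zG]; first by rewrite lex_leE; lia.
    have := inv_sorted inv; rewrite Gc /= => /(order_path_min lex_le_trans).
    by move/allP/(_ _ zG).
  subst h; have zNG : z \notin G by have := inv_uniq inv; rewrite Gc; case/andP.
  (* Popping [z] moves the columns due at [z] from the pending grades to the bound, whose index
     condition is vacuous at scan position 0. *)
  have inv0 : queue_inv (z.1, z.2 + 1) (before z)
      (fun k => ((g k).2 == z.2) && (0 <= k)%N) (set_gqueue G c).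
    case: inv; rewrite Gc => sound rhoV cq srt unq box fresh pend.
    split=> //.
    - exact: path_sorted srt.
    - by case/andP: unq.
    - move=> u uG /=; have := box u; rewrite inE uG orbT => /(_ isT).
      rewrite lexS; case: eqP => // uz; subst u.
      by rewrite uG in zNG.
    - move=> k le; have := fresh k; rewrite lexS le orbT inE => /(_ isT).
      by case: eqP => // ek; rewrite ek lexz in le.
    - move=> k Vk uns; have := pend k Vk uns; rewrite orbF inE /= => /andP[le].
      rewrite grade_eqE /= eqxx /= andbT => /orP[->|->]; first by rewrite orbT.
      by rewrite andbT; move: le; rewrite /z /=; lia.
  have [e [dr lws inv1]] := drain_sim zX inv0.
  have [|f [qs lws2 inv2]] := current_sim (a := 0) (c := e) zX.
    by apply: eq_queue_inv inv1 => k; rewrite ltn0 andbF orbF.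
  rewrite !drop0 in lws lws2 qs.
  exists f; split=> //.
    by exists (base e) => //=; rewrite columns_left_ofE //; case/andP: xX.
  by move=> d; apply: (queue_run_pop Gc); exists e.
have noz : columns_of_grade g z = [::].
  apply/eqP; rewrite -[_ == _]negbK -has_filter; apply/hasPn => k _.
  apply: contra Gz => /eqP gk.
  by rewrite -[z in z \in _]gk; apply: (inv_fresh inv); rewrite lexS gk eqxx.
have gkz k : g k != z.
  apply/negP => gk; have : k \in columns_of_grade g z.
    by rewrite mem_filter gk mem_enum.
  by rewrite noz.
have befE : before z =1 before (z.1, z.2 + 1).
  by move=> k; rewrite /before lexS (negbTE (gkz k)).
exists c; split=> //.
  exists (base c); last by rewrite noz; apply: for_each_nil.
  apply: for_each_stutter => k; rewrite columns_left_ofE; last by case/andP: xX.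
  rewrite mem_filter => /andP[/andP[/eqP gk xk] _].
  (* An unsettled column left of [z] would have [z] as its pending grade. *)
  apply: lw_visit_settled; apply: contraNT Gz => uns.
  have bef : before z k by rewrite /before lex_leE /= negb_or -leNgt (ltW xk) gt_eqF.
  by have := inv_pending inv bef uns; rewrite gk orbF => /andP[].
apply: (eq_queue_inv befE).
case: inv => sound rhoV cq srt unq box fresh pend; split=> //.
- move=> u uG; have := box u uG; rewrite lexS; case: eqP => // uz.
  by rewrite uz (negbTE Gz) in uG.
- by move=> k le; apply: fresh; rewrite lexS le orbT.
- move=> k Vk uns; have := pend k Vk uns; rewrite !orbF => /andP[le kG].
  rewrite /= kG andbT.
  have: (z.1, (g k).2) != z by apply: contraNneq Gz => <-.
  by rewrite grade_eqE /= eqxx /=; move: le; rewrite /z /=; lia.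
Qed.

(** * Traversal of the whole grid, one x-coordinate at a time *)

Lemma row_sim (x y r : nat) c : (0 < x <= X)%N ->
    queue_inv (x%:Z, y%:Z) (before (x%:Z, y%:Z)) pred0 c ->
  exists e, [/\ for_each (lw_cell g report) [seq (x, y') | y' <- iota y r]
      (base c) (base e),
    forall d, queue_run g report e d -> queue_run g report c d &
    queue_inv (x%:Z, (y + r)%:Z) (before (x%:Z, (y + r)%:Z)) pred0 e].
Proof.
move=> xX; elim: r y c => [|r IH] y c inv /=.
  by exists c; split; rewrite ?addn0 //; apply: for_each_nil.
have [e [lw run inv1]] := cell_sim xX inv.
have yS : y%:Z + 1 = y.+1%:Z by lia.
rewrite /= yS in inv1.
have [f [lws run2 inv2]] := IH _ _ inv1.
exists f; rewrite addnS -addSn; split=> //; first exact: for_each_cons lw lws.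
by move=> d /run2/run.
Qed.

(** No column has y-grade above [Y], so after the sweep at [x] the field [inv_pending] leaves no
    visited column unsettled, and the bound can jump to the next sweep. *)
Lemma next_row_inv x c :
    queue_inv (x, (1 + Y)%:Z) (before (x, (1 + Y)%:Z)) pred0 c ->
  queue_inv (x + 1, 1) (before (x + 1, 1)) pred0 c.
Proof.
move=> inv; apply: (@eq_queue_inv _ (before (x, (1 + Y)%:Z))).
  by move=> k; rewrite /before !lex_leE /=; have := grid_g k; lia.
case: inv => sound rhoV cq srt unq box fresh pend; split=> //.
- by move=> u /box; rewrite !lex_leE /=; lia.
- by move=> k le; apply: fresh; move: le; rewrite !lex_leE /=; lia.
- move=> k Vk uns; have := pend k Vk uns; rewrite /= orbF.
  by have := grid_g k; lia.
Qed.

Lemma run_sim (x r : nat) c : (0 < x)%N -> (x + r <= X.+1)%N ->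
    queue_inv (x%:Z, 1) (before (x%:Z, 1)) pred0 c ->
  exists e, [/\ for_each (lw_cell g report)
      [seq (x', y) | x' <- iota x r, y <- iota 1 Y] (base c) (base e),
    forall d, queue_run g report e d -> queue_run g report c d &
    queue_inv ((x + r)%:Z, 1) (before ((x + r)%:Z, 1)) pred0 e].
Proof.
elim: r x c => [|r IH] x c x0 xX inv.
  by exists c; split; rewrite ?addn0 //; apply: for_each_nil.
have [||e [lw run inv1]] := @row_sim x 1 Y c.
- by move: xX; lia.
- exact: inv.
have xS : x%:Z + 1 = x.+1%:Z by lia.
have := next_row_inv inv1; rewrite xS => inv2.
have [||f [lws run2 inv3]] := IH _ _ _ _ inv2; [by []|by lia|].
exists f; rewrite addnS -addSn; split=> //=; first exact: for_each_cat lw lws.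
by move=> d /run2/run.
Qed.

Lemma lw_queue_run (M : 'M['F_2]_(m, n)) :
  exists2 c, lw_run g report X Y (init_state M, [::]) (base c) &
    queue_run g report (init_queues g (init_state M, [::])) c.
Proof.
have sound0 : rho_sound (init_state M) by move=> i j; rewrite ffunE.
have [|||e [lw run inv]] := @run_sim 1 X
    (init_queues g (init_state M, [::])) => //.
  have bef k : before (1, 1) k = false.
    by rewrite /before lex_leE /=; have := grid_g k; lia.
  split=> //=.
  - by move=> i k; rewrite ffunE.
  - move=> y; rewrite -(filter_pred0 (enum 'I_n)); apply: eq_filter => k.
    by rewrite bef andbF.
  - exact: grade_queue_sorted.
  - exact: grade_queue_uniq.
  - move=> u; rewrite mem_grade_queue => /codomP[k ->].
    by rewrite lex_leE /=; have := grid_g k; lia.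
  - by move=> k _; rewrite mem_grade_queue codom_f.
  - by move=> k; rewrite bef.
exists e => //; apply/run/queue_run_empty.
(* The bound now has x-coordinate [X + 1], beyond every grade that may be queued, so the grade queue
   is empty. *)
case Ge: (gqueue e) => [//|u G]; have := inv_box inv (u := u).
by rewrite Ge mem_head lex_leE /= => /(_ isT); lia.
Qed.

End Simulation.

(** The simulation yields runs of both variants with a common output; determinism makes that output
    unique. *)
Lemma unique_outputs m n p (report : reporter m n p) (r : 'I_p -> grade)
    (X Y : nat) (M : gmatrix m n) :
    colex_sorted (cgrade M) -> in_grid X Y (cgrade M) ->
    (forall j s, report false j s s = None) ->
  exists D, unique (lw_output report r X Y M) D /\
            unique (queue_output report r M) D.
Proof.
move=> sorted_M grid_M idle.
have [c lw queue] := lw_queue_run sorted_M grid_M idle (entries M).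
exists (out_matrix r (base c).2); split; split.
- by exists (base c).
- by move=> D' [d /(lw_run_fun lw) <- ->].
- by exists c.
- by move=> D' [d /(queue_run_fun queue) <- ->].
Qed.

Theorem proposition4p2 (X Y n0 n1 n2 : nat)
    (A : gmatrix n1 n2) (B : gmatrix n0 n1)
    (complex_AB : short_chain_complex A B)
    (sorted_F0 : colex_sorted (rgrade B))
    (sorted_F1 : colex_sorted (cgrade B))
    (sorted_F2 : colex_sorted (cgrade A))
    (grid_A : in_grid X Y (cgrade A))
    (grid_B : in_grid X Y (cgrade B)) :
  (exists D, unique (min_gens_lw X Y A) D /\ unique (min_gens_queue A) D) /\
  (exists D, unique (ker_basis_lw X Y B) D /\ unique (ker_basis_queue B) D).
Proof.
(* Idle visits report nothing: [min_gens_report] requires the flag to be true, and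
   [ker_basis_report] would require one column to be both zero and nonzero. *)
split; apply: unique_outputs => // j s.
by rewrite /ker_basis_report andNb.
Qed.
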